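(* Let $n\ge2$. Let $A_1=\{1\text{-}23\}$, $A_2=\{2\text{-}13,21\text{-}3\}$, $A_3=\{2\text{-}31,23\text{-}1\}$, $A_4=\{3\text{-}12,31\text{-}2\}$. For every choice of $p_i\in A_i$ ($i=1,2,3,4$), $|S_n(p_1,p_2,p_3,p_4)|=2$ and $$S_n(p_1,p_2,p_3,p_4)=\{\,n\,(n-1)\ldots 1,\ \ 1\,n\,(n-1)\ldots 3\,2\,\}.$$
   Context: $S_n$ is the set of permutations $\pi=\pi_1\pi_2\cdots\pi_n$ of $\{1,\dots,n\}$ (written in one-line notation). For $abc$ a permutation of $123$, the generalized pattern $a\text{-}bc$ is contained in $\pi$ if there are indices $i<j$ with $j+1\le n$ such that $\pi_i\pi_j\pi_{j+1}$ is order-isomorphic to $abc$; the generalized pattern $ab\text{-}c$ is contained in $\pi$ if there are indices $i,k$ with $i+1<k\le n$ such that $\pi_i\pi_{i+1}\pi_k$ is order-isomorphic to $abc$. $\pi$ avoids a pattern if it does not contain it. $S_n(p_1,\dots,p_m)$ is the set of $\pi\in S_n$ avoiding all of $p_1,\dots,p_m$. *)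

(* Defs.v *)
From HB Require Import structures.
From mathcomp Require Import all_boot all_fingroup.

Set Implicit Arguments.
Unset Strict Implicit.
Unset Printing Implicit Defensive.

(* Positions are 0-based, while letters are shifted to {1, ..., n}. *)
Definition one_line n (pi : 'S_n) : seq nat :=
  [seq (pi i : nat).+1 | i <- enum 'I_n].

(* For words without repeated letters this is the usual order-isomorphism;
   equal letters are required to correspond as well, since both i, j and j, i
   are compared. *)
Definition order_iso (s t : seq nat) : bool :=
  (size s == size t) &&
  [forall i : 'I_(size s), forall j : 'I_(size s),
     (nth 0 s i < nth 0 s j) == (nth 0 t i < nth 0 t j)].

(* [dashL a b c] is the generalized pattern a-bc and [dashR a b c] is ab-c. *)
Variant gpattern :=
  | dashL of nat & nat & nat
  | dashR of nat & nat & nat.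

Definition gpattern_code (p : gpattern) : bool * (nat * nat * nat) :=
  match p with
  | dashL a b c => (false, (a, b, c))
  | dashR a b c => (true, (a, b, c))
  end.

Definition gpattern_decode (x : bool * (nat * nat * nat)) : gpattern :=
  let: (r, (a, b, c)) := x in if r then dashR a b c else dashL a b c.

Lemma gpattern_codeK : cancel gpattern_code gpattern_decode.
Proof. by case. Qed.

HB.instance Definition _ := Equality.copy gpattern (can_type gpattern_codeK).

Definition contains n (pi : 'S_n) (p : gpattern) : bool :=
  let w := one_line pi in
  match p with
  | dashL a b c =>
      [exists i : 'I_n, exists j : 'I_n,
        [&& i < j, j.+1 < n &
            order_iso [:: nth 0 w i; nth 0 w j; nth 0 w j.+1] [:: a; b; c]]]
  | dashR a b c =>
      [exists i : 'I_n, exists k : 'I_n,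
        (i.+1 < k) &&
            order_iso [:: nth 0 w i; nth 0 w i.+1; nth 0 w k] [:: a; b; c]]
  end.

Definition avoids n (pi : 'S_n) (p : gpattern) : bool := ~~ contains pi p.

Definition avoiders n (ps : seq gpattern) : {set 'S_n} :=
  [set pi : 'S_n | all (avoids pi) ps].

Definition A1 : seq gpattern := [:: dashL 1 2 3].
Definition A2 : seq gpattern := [:: dashL 2 1 3; dashR 2 1 3].
Definition A3 : seq gpattern := [:: dashL 2 3 1; dashR 2 3 1].
Definition A4 : seq gpattern := [:: dashL 3 1 2; dashR 3 1 2].

(* n (n-1) ... 1 *)
Definition decreasing_word (n : nat) : seq nat := rev (iota 1 n).

(* 1 n (n-1) ... 3 2 *)
Definition one_decreasing_word (n : nat) : seq nat := 1 :: rev (iota 2 n.-1).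

(* Main.v *)
Require Import Defs.
From mathcomp Require Import all_boot all_fingroup.
From mathcomp Require Import zify.

Set Implicit Arguments.
Unset Strict Implicit.
Unset Printing Implicit Defensive.

(** Whichever variants are chosen, an avoider has no three consecutive letters
    of shape 123, 213 or 312. These are exactly the shapes ending in an ascent,
    so the only possible ascent of an avoider is its first step. If that step is
    an ascent, then avoiding 2-31 or 23-1 keeps every later letter above the
    first one, which is therefore 1. *)

(** Diagonal comparisons are trivially equal, so six remain; in this form a pattern occurrence
    becomes plain arithmetic that [lia] can decide. *)
Lemma order_iso3E x y z a b c :
  order_iso [:: x; y; z] [:: a; b; c] =
  [&& (x < y) == (a < b), (y < x) == (b < a), (x < z) == (a < c),
      (z < x) == (c < a), (y < z) == (b < c) & (z < y) == (c < b)].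
Proof.
rewrite /order_iso /=; apply/forallP/and5P => [H | [H1 H2 H3 H4 /andP[H5 H6]] i].
- pose o i (hi : i < 3) := Ordinal hi.
  have E i j (hi : i < 3) (hj : j < 3) := forallP (H (o i hi)) (o j hj).
  split; [exact: (E 0 1) | exact: (E 1 0) | exact: (E 0 2)
          | exact: (E 2 0) | apply/andP].
  by split; [exact: (E 1 2) | exact: (E 2 1)].
- apply/forallP => j.
  by case: i => [[|[|[|//]]] ?]; case: j => [[|[|[|//]]] ?];
    rewrite /= ?ltnn //= ?eqxx.
Qed.

Section Words.

Variables (n : nat) (pi : 'S_n).
Let w := nth 0 (one_line pi).

Lemma size_one_line : size (one_line pi) = n.
Proof. by rewrite size_map size_enum_ord. Qed.

Lemma one_line_perm : perm_eq (one_line pi) (iota 1 n).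
Proof.
have inj_one : injective (fun i => (pi i : nat).+1).
  by move=> i j [] /ord_inj/perm_inj.
have u : uniq (one_line pi) by rewrite (map_inj_uniq inj_one) enum_uniq.
apply: uniq_perm; rewrite ?iota_uniq //.
suff sub : {subset one_line pi <= iota 1 n}.
  by apply: (uniq_min_size u sub _).2; rewrite size_iota size_one_line.
by move=> _ /mapP[i _ ->]; rewrite mem_iota; have := ltn_ord (pi i); lia.
Qed.

Lemma one_line_nth (i : 'I_n) : w i = (pi i).+1.
Proof.
rewrite /w (nth_map i) ?size_enum_ord ?ltn_ord //.
by rewrite nth_ord_enum.
Qed.

Lemma one_line_neq i j : i < n -> j < n -> i != j -> w i != w j.
Proof.
move=> hi hj hij; rewrite /w nth_uniq ?size_one_line //.
by rewrite (perm_uniq one_line_perm) iota_uniq.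
Qed.

Lemma containsLP a b c :
  reflect (exists i j, [/\ i < j, j.+1 < n &
             order_iso [:: w i; w j; w j.+1] [:: a; b; c]])
          (contains pi (dashL a b c)).
Proof.
apply: (iffP existsP) => [[i /existsP[j /and3P[? ? ?]]] | [i [j [hij hj H]]]].
  by exists i, j.
have hjn : j < n by lia.
have hin : i < n by lia.
by exists (Ordinal hin); apply/existsP; exists (Ordinal hjn); apply/and3P.
Qed.

Lemma containsRP a b c :
  reflect (exists i k, [/\ i.+1 < k, k < n &
             order_iso [:: w i; w i.+1; w k] [:: a; b; c]])
          (contains pi (dashR a b c)).
Proof.
apply: (iffP existsP) => [[i /existsP[k /andP[? ?]]] | [i [k [hik hk H]]]].
  by exists i, k.
have hin : i < n by lia.
by exists (Ordinal hin); apply/existsP; exists (Ordinal hk); apply/andP.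
Qed.

(** Three adjacent letters satisfy the adjacency requirement of a-bc and of ab-c alike, so the
    choice of variant does not matter for them. *)
Lemma avoids_consecutive a b c p k :
    p \in [:: dashL a b c; dashR a b c] -> avoids pi p -> k.+2 < n ->
  ~~ order_iso [:: w k; w k.+1; w k.+2] [:: a; b; c].
Proof.
rewrite !inE => /orP[]/eqP-> av hk; apply: contra av => H.
- by apply/containsLP; exists k, k.+1.
- by apply/containsRP; exists k, k.+2.
Qed.

(** A list sorted for the transitive, antisymmetric relation [gtn] is determined by its multiset of
    letters, here {1, ..., n}. *)
Lemma sorted_one_line :
  (forall k, k.+1 < n -> w k.+1 < w k) -> one_line pi = decreasing_word n.
Proof.
move=> dec; apply: (@sorted_eq _ gtn).
- by move=> x y z /= ? ?; lia.
- by move=> x y /=; lia.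
- by apply/(sortedP 0) => i; rewrite size_one_line => /dec.
- by rewrite rev_sorted; exact: iota_ltn_sorted.
- by rewrite perm_sym perm_rev perm_sym one_line_perm.
Qed.

Lemma sorted_behead_one_line :
    0 < n -> (forall k, 0 < k < n -> w 0 < w k) ->
    (forall k, k.+2 < n -> w k.+2 < w k.+1) ->
  one_line pi = one_decreasing_word n.
Proof.
move=> n_gt0 w0 dec.
have /(nthP 0)[k] : 1 \in one_line pi.
  by rewrite (perm_mem one_line_perm) mem_iota; lia.
rewrite size_one_line -/(w k) => hk wk.
have w_gt0 : 0 < w 0 by rewrite (one_line_nth (Ordinal n_gt0)).
have w01 : w 0 = 1.
  (* If the letter 1 stood at a position k > 0, the first letter would lie below 1, yet letters are
     positive. *)
  by case: (posnP k) wk => [-> // | k0]; have := w0 k; lia.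
move: w01 dec (one_line_perm) (size_one_line); rewrite /w /one_decreasing_word.
case: (one_line pi) => [|x t] //= -> dec pt st.
congr (_ :: _); apply: (@sorted_eq _ gtn).
- by move=> x' y z /= ? ?; lia.
- by move=> x' y /=; lia.
- by apply/(sortedP 0) => i hi; apply: dec; lia.
- by rewrite rev_sorted; exact: iota_ltn_sorted.
- rewrite perm_sym perm_rev perm_sym -(perm_cons 1).
  by move: pt; rewrite -[in iota 1 n](prednK n_gt0).
Qed.

End Words.

Lemma one_line_inj n : injective (@one_line n).
Proof.
move=> s t E; apply/permP => i; apply/val_inj/succn_inj.
by rewrite -!one_line_nth E.
Qed.

Lemma nth_decreasing_word n k : k < n -> nth 0 (decreasing_word n) k = n - k.
Proof.
by move=> hk; rewrite nth_rev ?size_iota ?nth_iota //; lia.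
Qed.

Lemma nth_one_decreasing_word n k :
  k < n -> nth 0 (one_decreasing_word n) k = if k == 0 then 1 else n.+1 - k.
Proof.
by case: k => //= k hk; rewrite nth_rev ?size_iota ?nth_iota //; lia.
Qed.

Lemma ex_decreasing n : exists pi : 'S_n, one_line pi = decreasing_word n.
Proof.
exists (perm (@rev_ord_inj n)); apply: sorted_one_line => k hk.
have hk' : k < n by lia.
rewrite (one_line_nth _ (Ordinal hk)) (one_line_nth _ (Ordinal hk')) !permE /=.
lia.
Qed.

Lemma ex_one_decreasing n :
  0 < n -> exists pi : 'S_n, one_line pi = one_decreasing_word n.
Proof.
case: n => // n _.
(* The length is now [n.+1] and values are 0-based: the letter n + 2 - i at position i > 0 becomes n
   + 1 - i, which is in range for [inord] exactly because i > 0. *)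
pose f (i : 'I_n.+1) : 'I_n.+1 :=
  if i == 0 :> nat then ord0 else inord (n.+1 - i).
have fE i : f i = (if i == 0 :> nat then 0 else n.+1 - i) :> nat.
  by rewrite /f; case: eqP => // i0; rewrite inordK //; lia.
have f_inj : injective f.
  move=> i j /(congr1 val); rewrite /= !fE => E; apply: ord_inj.
  by move: E (ltn_ord i) (ltn_ord j); do 2!case: eqP; lia.
have wE k : k < n.+1 ->
    nth 0 (one_line (perm f_inj)) k = (if k == 0 then 0 else n.+1 - k).+1.
  by move=> hk; rewrite (one_line_nth _ (Ordinal hk)) permE fE.
exists (perm f_inj).
by apply: sorted_behead_one_line => // -[|k] // hk; rewrite !wE //=; lia.
Qed.

Section Avoiders.

Variables (n : nat) (p1 p2 p3 p4 : gpattern).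
Hypotheses (h1 : p1 \in A1) (h2 : p2 \in A2) (h3 : p3 \in A3) (h4 : p4 \in A4).

Lemma avoiders_sub (pi : 'S_n) :
  0 < n -> pi \in avoiders n [:: p1; p2; p3; p4] ->
  one_line pi = decreasing_word n \/ one_line pi = one_decreasing_word n.
Proof.
move=> n_gt0; rewrite inE /= => /and5P[av1 av2 av3 av4 _].
set w := nth 0 (one_line pi).
have neq i j : i < n -> j < n -> i != j -> w i != w j := @one_line_neq n pi i j.
have dec k : k.+2 < n -> w k.+2 < w k.+1.
  (* [A1] offers a single variant; it is enlarged to the pair that [avoids_consecutive] expects. *)
  move=> hk; have h1' : p1 \in [:: dashL 1 2 3; dashR 1 2 3].
    by move: h1; rewrite !inE => ->.
  have := avoids_consecutive h1' av1 hk; have := avoids_consecutive h2 av2 hk.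
  have := avoids_consecutive h4 av4 hk; rewrite -/w !order_iso3E /=.
  (* Letters are distinct, so before an ascent the letter [w k] lies below, between or above its two
     letters, giving 123, 213 or 312. *)
  have := neq k k.+1; have := neq k k.+2; have := neq k.+1 k.+2; lia.
case: (ltnP 1 n) => n_gt1; last first.
  by left; apply: sorted_one_line => k hk; lia.
case: (ltnP (w 1) (w 0)) => [w10 | w01].
  by left; apply: sorted_one_line => -[|k] //; exact: dec.
right; apply: sorted_behead_one_line => // -[|k] //.
rewrite -/w; elim: k => [|k IHk] hk; first by have := neq 0 1; lia.
have {}IHk : w 0 < w k.+1 by apply: IHk; lia.
have n0k := neq 0 k.+2; have n01 := neq 0 1.
move: h3 av3; rewrite !inE => /orP[]/eqP->.
(* For 2-31, the induction hypothesis makes positions 0, k+1, k+2 an occurrence as soon as [w k.+2]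
   drops below [w 0]. *)
- move/containsLP => av; rewrite ltnNge; apply/negP => wk; apply: av.
  by exists 0, k.+1; split=> //; rewrite -/w order_iso3E /=; lia.
(* For 23-1, the initial ascent at positions 0 and 1 supplies the adjacent 23, and position k+2 the
   1. *)
- move/containsRP => av; rewrite ltnNge; apply/negP => wk; apply: av.
  by exists 0, k.+2; split=> //; rewrite -/w order_iso3E /=; lia.
Qed.

(** The decreasing word has no increasing pair, while each pattern contains one. In the other word
    every increasing pair starts with the leading 1. This excludes 123, 213 and 312, whose last two
    letters increase without being first, and 231, which needs a letter below its 2. *)
Lemma avoiders_sup (pi : 'S_n) :
  one_line pi = decreasing_word n \/ one_line pi = one_decreasing_word n ->
  pi \in avoiders n [:: p1; p2; p3; p4].
Proof.
move=> E; have {E} wE : (forall k, k < n -> nth 0 (one_line pi) k = n - k) \/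
    (forall k, k < n ->
       nth 0 (one_line pi) k = if k == 0 then 1 else n.+1 - k).
  case: E => ->; [left | right] => k.
  - exact: nth_decreasing_word.
  - exact: nth_one_decreasing_word.
have avL a b c : (a, b, c) \in [:: (1, 2, 3); (2, 1, 3); (2, 3, 1); (3, 1, 2)] ->
    avoids pi (dashL a b c).
  move=> habc; apply/containsLP => -[i [j [hij hj]]].
  have hi : i < n by lia.
  have hj' : j < n by lia.
  case: wE => wE; rewrite !wE // order_iso3E.
    by move: habc; rewrite !inE => /or4P[]/eqP[-> -> ->] /=; lia.
  (* Separating position 0 resolves the conditional in the formula for the second word. *)
  case: i j hi hj' hij hj => [|i] [|j] // hi hj' hij hj;
    by move: habc; rewrite !inE => /or4P[]/eqP[-> -> ->] /=; lia.
have avR a b c : (a, b, c) \in [:: (2, 1, 3); (2, 3, 1); (3, 1, 2)] ->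
    avoids pi (dashR a b c).
  move=> habc; apply/containsRP => -[i [k [hik hk]]].
  have hi : i < n by lia.
  have hi' : i.+1 < n by lia.
  case: wE => wE; rewrite !wE // order_iso3E.
    by move: habc; rewrite !inE => /or3P[]/eqP[-> -> ->] /=; lia.
  case: i k hi hi' hik hk => [|i] [|k] // hi hi' hik hk;
    by move: habc; rewrite !inE => /or3P[]/eqP[-> -> ->] /=; lia.
rewrite inE /=; apply/and5P; split=> //.
- by move: h1; rewrite !inE => /eqP->; exact: avL.
- by move: h2; rewrite !inE => /orP[]/eqP->; [exact: avL | exact: avR].
- by move: h3; rewrite !inE => /orP[]/eqP->; [exact: avL | exact: avR].
- by move: h4; rewrite !inE => /orP[]/eqP->; [exact: avL | exact: avR].
Qed.

End Avoiders.

Theorem proposition2p9 (n : nat) (hn : 2 <= n) (p1 p2 p3 p4 : gpattern)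
    (h1 : p1 \in A1) (h2 : p2 \in A2) (h3 : p3 \in A3) (h4 : p4 \in A4) :
  #|avoiders n [:: p1; p2; p3; p4]| = 2 /\
  avoiders n [:: p1; p2; p3; p4] =
    [set pi : 'S_n | (one_line pi == decreasing_word n)
                     || (one_line pi == one_decreasing_word n)].
Proof.
have n_gt0 : 0 < n by lia.
have E : avoiders n [:: p1; p2; p3; p4] =
    [set pi : 'S_n | (one_line pi == decreasing_word n)
                     || (one_line pi == one_decreasing_word n)].
  apply/setP => pi; rewrite [RHS]inE; apply/idP/orP.
  - by case/(avoiders_sub h1 h2 h3 h4 n_gt0) => ->; [left | right].
  - by case=> /eqP H; apply: avoiders_sup => //; [left | right].
split=> //; rewrite E.
have [s sE] := ex_decreasing n; have [t tE] := ex_one_decreasing n_gt0.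
have s_neq_t : s != t.
  (* The two words already differ in their first letters, n and 1, since n is at least 2. *)
  apply/eqP => st; have := nth_decreasing_word n_gt0.
  by rewrite -sE st tE nth_one_decreasing_word //=; lia.
rewrite (_ : [set _ | _] = [set s; t]) ?cards2 ?s_neq_t //.
apply/setP => pi; rewrite !inE -sE -tE.
by rewrite !(inj_eq (@one_line_inj n)).
Qed.
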